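(* Let $K$ be a field. Then $K$ has characteristic $0$ if and only if there is an irreducible polynomial $g\in K[X]$ such that $\mathrm{pow}(g)$ is closed in the $P$-topology for every prime ideal $P$ of $K[X]$ not containing $g$.
   Context: For a ring $R$ with group of units $U(R)$ and $a\in R$, $\mathrm{pow}(a):=\{ua^n \mid u\in U(R),\ n\geq 1\}$. For a prime ideal $P$ of $R=K[X]$, the $P$-topology is the topology on the set $R\setminus P$ generated by the sets $a+P^n$ for $a\in R\setminus P$ and $n\geq 1$ (the restriction of the $P$-adic topology to $R\setminus P$). If $g$ is irreducible and $g\notin P$ then $\mathrm{pow}(g)\subseteq R\setminus P$, and ''closed in the $P$-topology'' means closed as a subset of $R\setminus P$. *)

(* Defs.v *)
From HB Require Import structures.
From mathcomp Require Import all_boot all_order all_algebra.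
From mathcomp Require Import all_classical topology.

Set Implicit Arguments.
Unset Strict Implicit.
Unset Printing Implicit Defensive.

Import GRing.Theory.

Local Open Scope classical_set_scope.
Local Open Scope ring_scope.

Definition pow (R : comUnitRingType) (a : R) : set R :=
  [set x | exists u : R, exists n : nat,
     [/\ u \is a GRing.unit, (0 < n)%N & x = u * a ^+ n]].

(* Finite sums of products, so that for ideals I and J this is the ideal I J. *)
Definition ideal_mul (R : comNzRingType) (I J : set R) : set R :=
  [set x | exists s : seq (R * R),
     (forall z, z \in s -> I z.1 /\ J z.2) /\ x = \sum_(z <- s) z.1 * z.2].

(* The zeroth power is the whole ring. *)
Definition ideal_exp (R : comNzRingType) (I : set R) (n : nat) : set R :=
  iter n (ideal_mul I) setT.

(* The complement of P, as a type of its own so that it carries the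
   P-topology; closed sets of this type are the relatively closed subsets of
   the complement. *)
Definition prime_compl (R : comNzRingType) (P : prime_idealr R) : Type :=
  {a : R | a \notin P}.

HB.instance Definition _ (R : comNzRingType) (P : prime_idealr R) :=
  Choice.on (prime_compl P).

Definition compl_val (R : comNzRingType) (P : prime_idealr R) :
  prime_compl P -> R := @sval R (fun a => a \notin P).

Arguments compl_val {R} P _.

(* The sets a + P^n with a outside P and n >= 1. As n >= 1 they do not meet P,
   so taking the preimage under compl_val only changes the ambient type. *)
Definition P_subbase (R : comNzRingType) (P : prime_idealr R) :
    set (set (prime_compl P)) :=
  [set B | exists a : prime_compl P, exists n : nat, (0 < n)%N /\
     B = compl_val P @^-1`
           [set compl_val P a + z | z in ideal_exp [set x | x \in P] n]].

Arguments P_subbase {R} P _.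

HB.instance Definition _ (R : comNzRingType) (P : prime_idealr R) :=
  isSubBaseTopological.Build (prime_compl P) (P_subbase P) id.

(* Main.v *)
(** In characteristic 0 take [g = X].  If [f] is congruent to [c X^n] modulo
    [p^(k+1)], then, differentiating, [X f' - n f] vanishes modulo [p^k]; its
    degree is at most that of [f], so for large [k] it is zero, which forces
    [f] to be a monomial.  In characteristic [q > 0] choose [a] with
    [g(a) <> 0].  Modulo [P = (X - a)] the polynomial [h = g / g(a)] is 1, so
    [h^(q^m) - 1 = (h - 1)^(q^m)] tends to 0 in the [P]-topology, and 1 is a
    limit point of [pow g] outside [pow g]. *)
From HB Require Import structures.
Require Import Defs.
From mathcomp Require Import all_boot all_order all_algebra.
From mathcomp Require Import all_classical topology.

Set Implicit Arguments.
Unset Strict Implicit.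
Unset Printing Implicit Defensive.

Import GRing.Theory.

Local Open Scope classical_set_scope.
Local Open Scope ring_scope.

(** * Powers of an ideal *)

Section IdealPowers.
Variables (R : comNzRingType) (I : set R).

Lemma ideal_expD (n : nat) (x y : R) : (0 < n)%N ->
  ideal_exp I n x -> ideal_exp I n y -> ideal_exp I n (x + y).
Proof.
case: n => // n _ [s [sI ->]] [t [tI ->]]; exists (s ++ t).
by rewrite big_cat; split=> // z; rewrite mem_cat => /orP[/sI|/tI].
Qed.

Lemma ideal_expS_subset (n : nat) : ideal_exp I n.+1 `<=` ideal_exp I n.
Proof.
elim: n => [//|n IHn] x [s [sI ->]]; exists s; split=> // z /sI[Iz Jz].
by split=> //; apply: IHn.
Qed.

Lemma ideal_exp_subset (m n : nat) :
  (m <= n)%N -> ideal_exp I n `<=` ideal_exp I m.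
Proof.
move=> /subnK <-; elim: (n - m)%N => [//|k IHk] x.
by rewrite addSn => /ideal_expS_subset /IHk.
Qed.

Lemma ideal_exp0 (n : nat) : I 0 -> ideal_exp I n 0.
Proof. by case: n => // n I0; exists [::]; rewrite big_nil. Qed.

Lemma ideal_exp_expr (n : nat) (x : R) : I x -> ideal_exp I n (x ^+ n).
Proof.
move=> Ix; elim: n => [//|n IHn]; exists [:: (x, x ^+ n)].
by rewrite big_seq1 exprS; split=> // z; rewrite inE => /eqP ->.
Qed.

End IdealPowers.

(** * Neighbourhood filters of the P-topology *)

Section PTopology.
Variables (R : comNzRingType) (P : prime_idealr R).
Let I : set R := [set x | x \in P].

Definition P_nbhs (x : prime_compl P) : set_system (prime_compl P) :=
  filter_from [set n | (0 < n)%N]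
    (fun n => [set y | ideal_exp I n (compl_val P y - compl_val P x)]).

#[local] Instance P_nbhs_filter (x : prime_compl P) : Filter (P_nbhs x).
Proof.
apply: filter_from_filter; first by exists 1%N.
move=> m n m0 n0; exists (maxn m n); first by rewrite /= leq_max m0.
by move=> y /= Iy; split; apply: ideal_exp_subset Iy;
  rewrite ?leq_maxl ?leq_maxr.
Qed.

(** A subbasic set [a + P^n] that contains [x] also contains [x + P^n], because [P^n] is closed
    under addition. So the cosets [x + P^n], which decrease with [n], form a base of neighbourhoods
    at [x]. *)
Lemma P_open (A : set (prime_compl P)) :
  open A <-> forall x, A x -> P_nbhs x A.
Proof.
split=> [[D sD <-] x [B DB Bx]|nbA].
  suff : P_nbhs x B by apply: filterS => y By; exists B.
  have [E sE defB] := sD _ DB.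
  rewrite -defB; apply: filter_bigI => C EC.
  have Cx : C x by move: Bx; rewrite -defB; apply.
  have /set_mem[a [n [n0 defC]]] := sE _ EC.
  exists n => // y /= Iy.
  move: Cx; rewrite defC => -[z Iz axz].
  exists (z + (compl_val P y - compl_val P x)); first exact: ideal_expD.
  by rewrite addrA axz addrC subrK.
have -> : A = \bigcup_(B in [set B | P_subbase P B /\ B `<=` A]) B.
  rewrite eqEsubset; split=> [x Ax|x [B [_ BA] /BA]//].
  have [n n0 nA] := nbA x Ax.
  exists (compl_val P @^-1` [set compl_val P x + z | z in ideal_exp I n]).
    split; first by exists x, n.
    by move=> y [z Iz xz]; apply: nA; rewrite /= -xz addrC addKr.
  by exists 0; rewrite ?addr0 //; apply: ideal_exp0; apply: rpred0.
apply: bigcup_open => B [subB _]; exists [set B]; last by rewrite bigcup_set1.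
by move=> _ ->; apply: (finI_from1 id subB).
Qed.

End PTopology.

(** * Prime ideals of K[X] and divisibility *)

Section Polynomials.
Variable K : fieldType.
Implicit Types f g p : {poly K}.

(** Division with remainder by a nonzero element [p] of least size in [P], or [p = 0] if [P] is
    zero. A nonzero constant [p] would put 1 in [P]. *)
Lemma prime_ideal_poly_gen (P : prime_idealr {poly K}) :
  exists2 p : {poly K}, size p != 1%N & forall f, f \in P -> p %| f.
Proof.
pose Q n := `[< exists2 f, f \in P & f != 0 /\ size f = n >].
have [exQ|nQ] := pselect (exists n, Q n); last first.
  exists 0; first by rewrite size_poly0.
  move=> f Pf; rewrite dvd0p; apply/negPn/negP => f0.
  by apply: nQ; exists (size f); apply/asboolP; exists f.
have [n /asboolP[p Pp [p0 sp]] minn] := ex_minnP exQ.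
exists p => [|f Pf].
  apply/negP => /size_poly1P[c c0 pc].
  have := idealMr c^-1%:P Pp.
  by rewrite pc -polyCM mulVf // idealr1.
have Pr : f %% p \in P.
  rewrite [_ %% _](_ : _ = f - f %/ p * p) ?rpredB ?idealMr //.
  by rewrite [X in X - _](divp_eq f p) addrC addKr.
rewrite /dvdp; apply/negPn/negP => r0.
have := minn (size (f %% p)).
rewrite leqNgt -sp ltn_modp p0 => H.
by have : false by apply: H; apply/asboolP; exists (f %% p).
Qed.

Lemma dvdp_ideal_exp (I : set {poly K}) p (n : nat) f :
  (forall f, I f -> p %| f) -> ideal_exp I n f -> p ^+ n %| f.
Proof.
move=> Ip; elim: n f => [|n IHn] f; first by rewrite expr0 dvd1p.
move=> [s [sI ->]]; rewrite big_seq.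
elim/big_ind: _ => [|x y|z /sI[Iz Jz]]; [exact: dvdp0|exact: dvdp_add|].
by rewrite exprS dvdp_mul ?Ip ?IHn.
Qed.

(** * Derivatives modulo powers of a polynomial, and characteristic 0 *)

Lemma dvdp_exp_deriv p f (n : nat) : p ^+ n.+1 %| f -> p ^+ n %| f^`().
Proof.
move=> /dvdpP[h ->]; rewrite derivM deriv_exp /=; apply: dvdp_add.
  by rewrite exprS mulrA dvdp_mull.
by rewrite -mulrnAl mulrA dvdp_mull.
Qed.

(** The Euler operator X d/dX shifted by its eigenvalue [m]: it is diagonal on the monomials, with
    eigenvalue [i - m] on X^i. In characteristic 0 its kernel is therefore spanned by X^m. *)
Definition euler (m : nat) f : {poly K} := 'X * f^`() - f *+ m.

Lemma eulerB (m : nat) f g : euler m (f - g) = euler m f - euler m g.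
Proof. by rewrite /euler derivB mulrBr mulrnBl opprD addrACA -opprD. Qed.

Lemma coef_euler (m : nat) f (i : nat) :
  (euler m f)`_i = f`_i * (i%:R - m%:R).
Proof.
rewrite coefB coefXM coefMn coef_deriv mulrBr !mulr_natr.
by case: i => [|i] //=; rewrite mulr0n.
Qed.

Lemma size_euler (m : nat) f : (size (euler m f) <= size f)%N.
Proof.
by apply/leq_sizeP => i fi; rewrite coef_euler nth_default // mul0r.
Qed.

Lemma euler_monomial (m : nat) (c : K) : euler m (c *: 'X^m) = 0.
Proof.
apply/polyP => i; rewrite coef_euler coefZ coefXn coef0.
by case: eqP => [->|_]; rewrite ?subrr ?mulr0 ?mul0r.
Qed.

Lemma pchar0_natr_inj : [pchar K] =i pred0 -> injective (fun n => n%:R : K).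
Proof.
move=> /pcharf0P ch0 m n /=; wlog mn : m n / (m <= n)%N => [W|].
  by case/orP: (leq_total m n) => /W H => [/H|/esym/H/esym].
move=> e; apply/eqP; rewrite eqn_leq mn -subn_eq0 -ch0 natrB //.
by rewrite e subrr eqxx.
Qed.

Lemma euler_eq0 (m : nat) f :
  [pchar K] =i pred0 -> euler m f = 0 -> f = f`_m *: 'X^m.
Proof.
move=> ch0 f0; apply/polyP => i; rewrite coefZ coefXn.
have [->|im] := eqVneq; first by rewrite mulr1.
have := coef_euler m f i; rewrite f0 coef0 mulr0 => /esym/eqP.
by rewrite mulf_eq0 subr_eq0 (inj_eq (pchar0_natr_inj ch0)) (negPf im) orbF
  => /eqP.
Qed.

Lemma closed_powX (P : prime_idealr {poly K}) :
  [pchar K] =i pred0 -> closed (compl_val P @^-1` pow 'X).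
Proof.
move=> ch0; rewrite -openC; apply/P_open => x powx.
have [p p1 pP] := prime_ideal_poly_gen P.
set f := compl_val P x.
(* Differentiating costs one factor [p], which leaves [p ^+ size f]. For nonconstant [p] this has
   degree at least [size f], too large to divide a nonzero [euler m f]. The radius does not depend
   on [m], which is only known once [y] is given. *)
exists (size f).+1 => // y /(dvdp_ideal_exp pP) pfy [u [m [uu m0 ym]]].
apply: powx; rewrite /= -/f.
have [c c0 uc] : exists2 c, c != 0 & u = c%:P.
  by apply/size_poly1P; move: uu; rewrite poly_unitE => /andP[].
have : p ^+ size f %| euler m (compl_val P y - f).
  rewrite dvdp_sub ?dvdp_mull ?dvdp_exp_deriv // -mulr_natr dvdp_mulr //.
  by apply: dvdp_trans pfy; rewrite exprS dvdp_mull.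
rewrite eulerB ym uc mul_polyC euler_monomial sub0r dvdpNr => pe.
have e0 : euler m f = 0.
  apply/eqP/negPn/negP => e0.
  have := leq_trans (dvdp_leq e0 pe) (size_euler m f).
  (* If [p = 0], then [0 ^+ size f] is 0 unless [f = 0]; either way [euler m f] vanishes. *)
  have p0 : p != 0.
    apply: contraNneq e0 => p0; move: pe; rewrite p0 expr0n size_poly_eq0.
    have [fz _|_] := eqVneq f 0; last by rewrite dvd0p.
    by rewrite fz /euler deriv0 mulr0 mul0rn subrr.
  rewrite leqNgt => /negP; apply; rewrite -ltnS.
  have sp : (0 < (size p).-1)%N.
    by move: p1; rewrite -size_poly_gt0 in p0 *; case: (size p) p0 => [|[]].
  have : (size (p ^+ size f) > 0)%N by rewrite size_poly_gt0 expf_neq0.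
  move=> /prednK <-; rewrite size_exp !ltnS.
  exact: leq_pmull.
have fm := euler_eq0 ch0 e0.
exists (f`_m)%:P, m; split => //; last by rewrite mul_polyC.
(* The coefficient is a unit: were it 0, then [f = 0] would lie in [P]. *)
rewrite poly_unitE size_polyC coefC /= unitfE andbC.
case: eqVneq => //= fm0; have := svalP x.
by rewrite -[sval x]/f fm fm0 scale0r rpred0.
Qed.

(** * Positive characteristic and the prime ideals (X - a) *)

Definition root_at (a : K) : {poly K} -> bool := fun f => root f a.

Lemma root_at_ideal (a : K) : idealr_closed (root_at a).
Proof.
rewrite /root_at; split; rewrite ?unfold_in ?root0 ?root1 //.
move=> f u v; rewrite !unfold_in !rootE hornerD hornerM => /eqP -> /eqP ->.
by rewrite mulr0 addr0.
Qed.

Lemma root_at_prime (a : K) : prime_idealr_closed (root_at a).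
Proof. by move=> u v; rewrite !unfold_in /root_at rootM. Qed.

HB.instance Definition _ (a : K) :=
  isIdealr.Build {poly K} (root_at a) (root_at_ideal a).
HB.instance Definition _ (a : K) :=
  isPrimeIdealrClosed.Build {poly K} (root_at a) (root_at_prime (a := a)).

(** Over a finite field a nonzero polynomial may vanish everywhere, but an irreducible one that
    vanishes at 0 is associate to X, hence does not vanish at 1. *)
Lemma irreducible_nonroot g : irreducible_poly g -> exists a, ~~ root g a.
Proof.
move=> [_ irr]; have [g0|] := boolP (root g 0); last by exists 0.
have [g1|] := boolP (root g 1); last by exists 1.
have /irr /(_ _)/eqp_root gX : size ('X - 0%:P : {poly K}) != 1%N.
  by rewrite size_XsubC.
by move: g1; rewrite -gX ?dvdp_XsubCl // root_XsubC oner_eq0.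
Qed.

Lemma pow_not_closed (q : nat) g a :
  q \in [pchar K] -> (1 < size g)%N -> ~~ root g a ->
  ~ closed (compl_val (root_at a) @^-1` pow g).
Proof.
move=> chq g1 ga; rewrite -openC => /P_open.
have P1 : (1 : {poly K}) \notin root_at a by rewrite unfold_in /root_at root1.
move=> /(_ (exist (fun f => f \notin root_at a) _ P1)) [].
  (* 1 is outside [pow g]: as the exponent is positive, [g] would divide 1. *)
  move=> [u [n [_ n0 /= /esym gn]]].
  have : g %| 1 by rewrite -gn -(prednK n0) exprS mulrCA dvdp_mulr.
  by rewrite dvdp1 eqn_leq leqNgt g1.
move=> n n0 nsub; pose h := g.[a]^-1%:P * g.
have gq : (0 < q)%N by apply/prime_gt0/pcharf_prime/chq.
have Ph : h ^+ (q ^ n) \notin root_at a.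
  rewrite unfold_in /root_at rootE horner_exp hornerM hornerC mulVf //.
  by rewrite expr1n oner_eq0.
have hP : ideal_exp [set x | x \in root_at a] n (h ^+ (q ^ n) - 1).
  have qnP : [pchar {poly K}].-nat (q ^ n)%N.
    have chP : q \in [pchar {poly K}] by rewrite pchar_poly.
    by rewrite (eq_pnat _ (pcharf_eq chP)) pnatX pnat_id ?(pcharf_prime chq).
  (* By Frobenius the difference is [(h - 1) ^+ (q ^ n)], where [h - 1] vanishes at [a]; since
     [q ^ n] exceeds [n], it lies in the [n]-th power of the ideal. *)
  rewrite -[X in _ - X](expr1n _ (q ^ n)) -exprNn_pchar // -exprDn_pchar //.
  apply: (@ideal_exp_subset _ _ n (q ^ n)).
    by apply/ltnW/ltn_expl/prime_gt1/pcharf_prime/chq.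
  apply: ideal_exp_expr; rewrite /= unfold_in /root_at rootE.
  by rewrite hornerD hornerN !hornerE mulVf // subrr.
apply: (nsub (exist (fun f => f \notin root_at a) _ Ph) hP).
exists (g.[a]^-1 ^+ (q ^ n))%:P, (q ^ n)%N; split.
- by rewrite poly_unitE size_polyC coefC /= unitfE expf_neq0 ?invr_eq0.
- by rewrite expn_gt0 gq.
- by rewrite /= /h exprMn polyC_exp.
Qed.

End Polynomials.

Theorem proposition4p1 (K : fieldType) :
  [pchar K] =i pred0 <->
  exists g : {poly K}, irreducible_poly g /\
    forall P : prime_idealr {poly K}, g \notin P ->
      closed (compl_val P @^-1` pow g).
Proof.
split=> [ch0|[g [irr cl]] q].
  exists 'X; split=> [|P _]; last exact: closed_powX.
  by rewrite -['X]subr0; apply: irredp_XsubC.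
apply/negbTE/negP => chq; have [a ga] := irreducible_nonroot irr.
exact: pow_not_closed chq irr.1 ga (cl (root_at a) ga).
Qed.
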